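(* Let $D$ be a 0-dialgebra over a field of characteristic not $2$ or $3$, and let $\mathrm{N_{alt}}(D)$ be its generalized alternative di-nucleus. Then $(\mathrm{N_{alt}}(D), \langle -,- \rangle)$, i.e. $\mathrm{N_{alt}}(D)$ endowed with the dicommutator $\langle x,y\rangle = x\dashv y - y\vdash x$ as product, is a Malcev dialgebra.
   Context: A dialgebra is a vector space $D$ with two bilinear operations $\dashv,\vdash\colon D\times D\to D$ (the left and right products). A 0-dialgebra is a dialgebra satisfying the bar identities $(x\dashv y)\vdash z = (x\vdash y)\vdash z$ and $x\dashv(y\dashv z) = x\dashv(y\vdash z)$ for all $x,y,z$. The left, inner and right associators are $(x,y,z)_\dashv = (x\dashv y)\dashv z - x\dashv(y\dashv z)$, $(x,y,z)_\times = (x\vdash y)\dashv z - x\vdash(y\dashv z)$, $(x,y,z)_\vdash = (x\vdash y)\vdash z - x\vdash(y\vdash z)$. The generalized alternative di-nucleus $\mathrm{N_{alt}}(D)$ of a 0-dialgebra $D$ is the set of all $a\in D$ such that for all $x,y\in D$: (GAN1) $(a,x,y)_\dashv = -(x,a,y)_\times = (x,y,a)_\vdash$; (GAN2) $(a,x,y)_\times = -(x,a,y)_\dashv = (x,y,a)_\dashv$; (GAN3) $(a,x,y)_\vdash = -(x,a,y)_\vdash = (x,y,a)_\times$. Over a field of characteristic not $2$, a (right) Malcev dialgebra is a vector space with a bilinear operation $xy$ (mapping the space into itself) satisfying right anticommutativity $x(yz)+x(zy)=0$ and the di-Malcev identity $((xy)z)t - ((xt)y)z - (x(zt))y - (xz)(yt)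 - x((yz)t) = 0$. *)

(* Defs.v *)
From HB Require Import structures.
From mathcomp Require Import all_boot all_algebra.
From mathcomp Require Import boolp.

Set Implicit Arguments.
Unset Strict Implicit.
Unset Printing Implicit Defensive.

Import GRing.Theory.
Local Open Scope ring_scope.

Reserved Notation "x ⊣ y" (at level 40, left associativity).
Reserved Notation "x ⊢ y" (at level 40, left associativity).

HB.mixin Record Lmodule_isDialgebra (F : fieldType) (D : Type)
    of GRing.Lmodule F D := {
  ldprod : {bilinear D -> D -> D};
  rdprod : {bilinear D -> D -> D}
}.

#[short(type="dialgType")]
HB.structure Definition Dialgebra (F : fieldType) :=
  {D of GRing.Lmodule F D & Lmodule_isDialgebra F D}.

Declare Scope dialg_scope.
Delimit Scope dialg_scope with dialg.
Notation "x ⊣ y" := (ldprod x y) : dialg_scope.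
Notation "x ⊢ y" := (rdprod x y) : dialg_scope.
Local Open Scope dialg_scope.

HB.mixin Record Dialgebra_isZero (F : fieldType) (D : Type)
    of Dialgebra F D := {
  left_bar : forall x y z : D, (x ⊣ y) ⊢ z = (x ⊢ y) ⊢ z;
  right_bar : forall x y z : D, x ⊣ (y ⊣ z) = x ⊣ (y ⊢ z)
}.

#[short(type="zeroDialgType")]
HB.structure Definition ZeroDialgebra (F : fieldType) :=
  {D of Dialgebra F D & Dialgebra_isZero F D}.

Section Dialgebra.
Variables (F : fieldType) (D : dialgType F).
Implicit Types x y z : D.

Definition lassoc x y z : D := (x ⊣ y) ⊣ z - x ⊣ (y ⊣ z).
Definition iassoc x y z : D := (x ⊢ y) ⊣ z - x ⊢ (y ⊣ z).
Definition rassoc x y z : D := (x ⊢ y) ⊢ z - x ⊢ (y ⊢ z).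

Definition dicommutator x y : D := x ⊣ y - y ⊢ x.

End Dialgebra.

Section GeneralizedAlternativeDinucleus.
Variables (F : fieldType) (D : zeroDialgType F).
Implicit Types a x y : D.

Definition GAN1 a := forall x y,
  lassoc a x y = - iassoc x a y /\ - iassoc x a y = rassoc x y a.
Definition GAN2 a := forall x y,
  iassoc a x y = - lassoc x a y /\ - lassoc x a y = lassoc x y a.
Definition GAN3 a := forall x y,
  rassoc a x y = - rassoc x a y /\ - rassoc x a y = iassoc x y a.

Definition Nalt : {pred D} := fun a => `[< [/\ GAN1 a, GAN2 a & GAN3 a] >].

Lemma NaltP a : reflect [/\ GAN1 a, GAN2 a & GAN3 a] (a \in Nalt).
Proof. exact: asboolP. Qed.

Let lassocP k x1 x2 y z :
  [/\ lassoc (k *: x1 + x2) y z = k *: lassoc x1 y z + lassoc x2 y z,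
      lassoc y (k *: x1 + x2) z = k *: lassoc y x1 z + lassoc y x2 z &
      lassoc y z (k *: x1 + x2) = k *: lassoc y z x1 + lassoc y z x2].
Proof.
by split; rewrite /lassoc ?(linearPl, linearPr) ?(linearPl, linearPr) scalerBr
  opprD addrACA.
Qed.

Let iassocP k x1 x2 y z :
  [/\ iassoc (k *: x1 + x2) y z = k *: iassoc x1 y z + iassoc x2 y z,
      iassoc y (k *: x1 + x2) z = k *: iassoc y x1 z + iassoc y x2 z &
      iassoc y z (k *: x1 + x2) = k *: iassoc y z x1 + iassoc y z x2].
Proof.
by split; rewrite /iassoc ?(linearPl, linearPr) ?(linearPl, linearPr) scalerBr
  opprD addrACA.
Qed.

Let rassocP k x1 x2 y z :
  [/\ rassoc (k *: x1 + x2) y z = k *: rassoc x1 y z + rassoc x2 y z,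
      rassoc y (k *: x1 + x2) z = k *: rassoc y x1 z + rassoc y x2 z &
      rassoc y z (k *: x1 + x2) = k *: rassoc y z x1 + rassoc y z x2].
Proof.
by split; rewrite /rassoc ?(linearPl, linearPr) ?(linearPl, linearPr) scalerBr
  opprD addrACA.
Qed.

Lemma Nalt_submod_closed : submod_closed Nalt.
Proof.
split=> [|k a b /NaltP[a1 a2 a3] /NaltP[b1 b2 b3]].
  apply/NaltP; split=> x y; rewrite /lassoc /iassoc /rassoc;
    by rewrite !(linear0l, linear0r) !subrr oppr0; split.
have L x y := lassocP k a b x y.
have I x y := iassocP k a b x y.
have R x y := rassocP k a b x y.
apply/NaltP; split=> x y.
- have [_ -> _] := I x y; have [-> _ _] := L x y; have [_ _ ->] := R x y.
  by have [-> <-] := a1 x y; have [-> <-] := b1 x y; rewrite scalerN -opprD.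
- have [-> _ _] := I x y; have [_ -> ->] := L x y.
  by have [-> <-] := a2 x y; have [-> <-] := b2 x y; rewrite scalerN -opprD.
- have [_ _ ->] := I x y; have [-> -> _] := R x y.
  by have [-> <-] := a3 x y; have [-> <-] := b3 x y; rewrite scalerN -opprD.
Qed.

(* The vector space structure on the di-nucleus comes from
   Nalt_submod_closed; nothing is asserted here about its stability under the
   dicommutator. *)
HB.instance Definition _ :=
  GRing.isSubmodClosed.Build F D Nalt Nalt_submod_closed.

Record Nalt_type := NaltElt {Nalt_val :> D; _ : Nalt_val \in Nalt}.

HB.instance Definition _ := [isSub for Nalt_val].
HB.instance Definition _ := [Choice of Nalt_type by <:].
HB.instance Definition _ := [SubChoice_isSubLmodule of Nalt_type by <:].

End GeneralizedAlternativeDinucleus.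

Definition malcev_dialgebra (F : fieldType) (V : lmodType F)
    (mul : {bilinear V -> V -> V}) : Prop :=
  [/\ 2%N \notin [pchar F],
      forall x y z, mul x (mul y z) + mul x (mul z y) = 0 &
      forall x y z t,
        mul (mul (mul x y) z) t - mul (mul (mul x t) y) z
        - mul (mul x (mul z t)) y - mul (mul x z) (mul y t)
        - mul x (mul (mul y z) t) = 0].

(* Main.v *)
Require Import Defs.
From HB Require Import structures.
From mathcomp Require Import all_boot all_algebra.

Set Implicit Arguments.
Unset Strict Implicit.
Unset Printing Implicit Defensive.

Import GRing.Theory.
Local Open Scope ring_scope.

(* Write L_a = a ⊢ _ and R_a = _ ⊣ a. The axioms (GAN2) and (GAN3) say that
   (L_a, L_a + R_a, - L_a) and (R_a, - R_a, L_a + R_a) are ternary derivations,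
   d1 (x y) = d2 x y + x d3 y, of both products; (GAN1) says the same of
   a ⊣ _ and _ ⊢ a, seen as maps from D modulo the bar identities to D. Ternary
   derivations are closed under commutators, and for c = <a, b> one has
   L_c = [L_a, L_b] + 2 [L_a, R_b] and R_c = - [R_a, R_b] - 2 [L_a, R_b], so
   the di-nucleus is closed under the dicommutator.

   For a, b in the di-nucleus, <<v, b>, a> - <<v, a>, b> + <v, <a, b>> is
   6 (a, v, b)_×. Five instances of this identity turn the di-Malcev identity
   into 6 times a relation between inner associators, which is the sum of two
   Teichmüller identities. *)

(* The tactic [zmod] decides equations between Z-linear combinations in an
   abelian group by comparing coefficients, as [ring] needs a commutative
   ring. *)
Inductive zexpr :=
  | ZVar of nat
  | ZZero
  | ZAdd of zexpr & zexpr
  | ZOpp of zexpr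
  | ZMuln of zexpr & nat.

Fixpoint zeval (V : zmodType) (env : seq V) (e : zexpr) : V :=
  match e with
  | ZVar i => env`_i
  | ZZero => 0
  | ZAdd e1 e2 => zeval env e1 + zeval env e2
  | ZOpp e1 => - zeval env e1
  | ZMuln e1 n => zeval env e1 *+ n
  end.

Fixpoint zcoef (e : zexpr) (i : nat) : int :=
  match e with
  | ZVar j => (i == j)%:Z
  | ZZero => 0
  | ZAdd e1 e2 => zcoef e1 i + zcoef e2 i
  | ZOpp e1 => - zcoef e1 i
  | ZMuln e1 n => zcoef e1 i * n%:Z
  end.

Lemma zevalE (V : zmodType) (env : seq V) (e : zexpr) :
  zeval env e = \sum_(i < size env) env`_i *~ zcoef e i.
Proof.
elim: e => /= [j||e1 -> e2 ->|e1 ->|e1 -> n].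
- have [lt_j|le_j] := ltnP j (size env); last first.
    (* An index past the end of [env] reads the default 0, and no summand carries that index. *)
    rewrite nth_default // big1 // => i _.
    by rewrite (ltn_eqF (leq_trans (ltn_ord i) le_j)).
  rewrite (bigD1 (Ordinal lt_j)) //= eqxx big1 ?addr0 // => i /negPf.
  by rewrite -val_eqE /= => ->.
- by rewrite big1.
- by rewrite -big_split; apply: eq_bigr => i _; rewrite mulrzDr.
- by rewrite -sumrN; apply: eq_bigr => i _; rewrite mulrNz.
- by rewrite -sumrMnl; apply: eq_bigr => i _; rewrite pmulrn mulrzA.
Qed.

Lemma zeval_eq (V : zmodType) (env : seq V) (n : nat) (e1 e2 : zexpr) :
    size env = n -> all (fun i => zcoef e1 i == zcoef e2 i) (iota 0 n) ->
  zeval env e1 = zeval env e2.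
Proof.
move=> <- /allP eq12; rewrite !zevalE; apply: eq_bigr => i _.
by rewrite (eqP (eq12 i _)) // mem_iota ltn_ord.
Qed.

Ltac zmod_index x env :=
  lazymatch env with
  | x :: _ => constr:(0%N)
  | _ :: ?env' => let i := zmod_index x env' in constr:(i.+1)
  end.

Ltac zmod_atoms env t :=
  lazymatch t with
  | ?a + ?b => let env1 := zmod_atoms env a in zmod_atoms env1 b
  | - ?a => zmod_atoms env a
  | ?a *+ ?n => zmod_atoms env a
  | 0 => env
  | _ => match constr:(Set) with
         | _ => let _ := zmod_index t env in env
         | _ => constr:(t :: env)
         end
  end.

Ltac zmod_reify env t :=
  lazymatch t with
  | ?a + ?b =>
      let e1 := zmod_reify env a in
      let e2 := zmod_reify env b in constr:(ZAdd e1 e2)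
  | - ?a => let e := zmod_reify env a in constr:(ZOpp e)
  | ?a *+ ?n => let e := zmod_reify env a in constr:(ZMuln e n)
  | 0 => constr:(ZZero)
  | _ => let i := zmod_index t env in constr:(ZVar i)
  end.

Ltac zmod :=
  lazymatch goal with
  | |- @eq ?V ?u ?v =>
      let env0 := zmod_atoms (@nil V) u in
      let env := zmod_atoms env0 v in
      let e1 := zmod_reify env u in
      let e2 := zmod_reify env v in
      apply: (@zeval_eq _ env _ e1 e2 erefl); vm_compute; reflexivity
  end.

(* Closes [u = v] by a linear combination [s = t] of known equations. *)
Lemma zmod_from (V : zmodType) (s t u v : V) :
  s = t -> u - v = s - t -> u = v.
Proof. by move=> ->; rewrite subrr => /eqP; rewrite subr_eq0 => /eqP. Qed.

Lemma eq_addr (V : zmodType) (s t u v : V) : s = t -> u = v -> s + u = t + v.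
Proof. by move=> -> ->. Qed.

(** * Commutators of ternary derivations *)

Section GeneralizedDerivations.
Variables (K : nzRingType) (D : lmodType K).
Implicit Types (m p q : {bilinear D -> D -> D}) (l r L R : {additive D -> D}).

(* The three products differ only for (GAN1), where [l] and [r] send D modulo
   the bar identities to D: [m] is then the product of that quotient, and [p],
   [q] are its right and left actions on D. *)
Definition gnder m p q (l r : D -> D) := forall x y,
  l (m x y) = p (l x + r x) y - q x (l y) /\
  r (m x y) = - p (r x) y + q x (l y + r y).

(** The hypotheses on [lc] and [rc] read lc = [l, L] + 2 [l, R] and rc = - [r, R] - 2 [l, R]. The
    condition [l, R] = [r, L] serves to eliminate the composite of [r] after [L]; the remaining
    terms cancel formally. *)
Lemma gnder_bracket m p q l r L R (lc rc : D -> D) :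
    gnder m p q l r -> gnder m m m L R -> gnder p p p L R -> gnder q q q L R ->
    (forall v, l (R v) - R (l v) = r (L v) - L (r v)) ->
    (forall v, lc v = l (L v) - L (l v) + (l (R v) - R (l v)) *+ 2) ->
    (forall v, rc v = R (r v) - r (R v) - (l (R v) - R (l v)) *+ 2) ->
  gnder m p q lc rc.
Proof.
move=> lrP mP pP qP skew lcE rcE x y.
have lE u v := (lrP u v).1; have rE u v := (lrP u v).2.
have mL u v := (mP u v).1; have mR u v := (mP u v).2.
have pL u v := (pP u v).1; have pR u v := (pP u v).2.
have qL u v := (qP u v).1; have qR u v := (qP u v).2.
have rL v : r (L v) = l (R v) - R (l v) + L (r v) by rewrite skew subrK.
pose addE := (raddfD l, raddfD r, raddfD L, raddfD R).
pose oppE := (raddfN l, raddfN r, raddfN L, raddfN R).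
pose pqD := (linearDl p, linearDr p, linearDl q, linearDr q).
pose pqN := (linearNl p, linearNr p, linearNl q, linearNr q).
pose pqMn := (linearMnl p, linearMnr p, linearMnl q, linearMnr q).
rewrite !lcE !rcE !(mL, mR).
rewrite !(addE, oppE, lE, rE, pL, pR, qL, qR).
by rewrite !(pqD, pqN, pqMn, rL) /=; split; zmod.
Qed.

End GeneralizedDerivations.

(** * The di-nucleus of two products satisfying the bar identities *)

Section BarIdentities.
Variables (K : nzRingType) (D : lmodType K) (ld rd : {bilinear D -> D -> D}).
Local Notation "x ⊣ y" := (ld x y) : ring_scope.
Local Notation "x ⊢ y" := (rd x y) : ring_scope.
Hypothesis lbar : forall x y z : D, (x ⊣ y) ⊢ z = (x ⊢ y) ⊢ z.
Hypothesis rbar : forall x y z : D, x ⊣ (y ⊣ z) = x ⊣ (y ⊢ z).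
Implicit Types (a b c v w x y z t : D).

Definition las x y z : D := (x ⊣ y) ⊣ z - x ⊣ (y ⊣ z).
Definition ias x y z : D := (x ⊢ y) ⊣ z - x ⊢ (y ⊣ z).
Definition ras x y z : D := (x ⊢ y) ⊢ z - x ⊢ (y ⊢ z).
Definition com x y : D := x ⊣ y - y ⊢ x.

(** The chains (GAN1) to (GAN3) are cut into six rewriting rules, each trading [a] in an outer place
    for [a] in the middle. *)
Record gan a : Prop := Gan {
  gan1l : forall x y, las a x y = - ias x a y;
  gan1r : forall x y, ras x y a = - ias x a y;
  gan2l : forall x y, ias a x y = - las x a y;
  gan2r : forall x y, las x y a = - las x a y;
  gan3l : forall x y, ras a x y = - ras x a y;
  gan3r : forall x y, ias x y a = - ras x a y
}.

Let ldE := (linearDl ld, linearDr ld, linearNl ld, linearNr ld).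
Let rdE := (linearDl rd, linearDr rd, linearNl rd, linearNr rd).

(** Each rule of [gan], solved for the term where [a] acts on a product of [x] and [y], is one half
    of a [gnder]; the bar identities adjust the inner products. *)
Lemma ganP a : gan a <->
  [/\ gnder rd ld rd (ld a) (applyr rd a),
      gnder ld ld ld (rd a) (applyr ld a) &
      gnder rd rd rd (rd a) (applyr ld a)].
Proof.
split=> [aP|[aP1 aP2 aP3]].
  split=> x y; split; rewrite /applyr_head !(ldE, rdE) ?(lbar, rbar).
  - apply: zmod_from (esym (gan1l aP x y)) _.
    by rewrite /las /ias ?(lbar, rbar); zmod.
  - apply: zmod_from (gan1r aP x y) _.
    by rewrite /ras /ias ?(lbar, rbar); zmod.
  - apply: zmod_from (esym (gan2l aP x y)) _.
    by rewrite /las /ias ?(lbar, rbar); zmod.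
  - apply: zmod_from (gan2r aP x y) _.
    by rewrite /las ?(lbar, rbar); zmod.
  - apply: zmod_from (esym (gan3l aP x y)) _.
    by rewrite /ras ?(lbar, rbar); zmod.
  - apply: zmod_from (gan3r aP x y) _.
    by rewrite /ras /ias ?(lbar, rbar); zmod.
split=> x y.
- have := (aP1 x y).1; rewrite /applyr_head !(ldE, rdE) => /esym E.
  by apply: zmod_from E _; rewrite /las /ias ?(lbar, rbar); zmod.
- have := (aP1 x y).2; rewrite /applyr_head !(ldE, rdE) => E.
  by apply: zmod_from E _; rewrite /ras /ias ?(lbar, rbar); zmod.
- have := (aP2 x y).1; rewrite /applyr_head !(ldE, rdE) => /esym E.
  by apply: zmod_from E _; rewrite /las /ias ?(lbar, rbar); zmod.
- have := (aP2 x y).2; rewrite /applyr_head !(ldE, rdE) => E.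
  by apply: zmod_from E _; rewrite /las ?(lbar, rbar); zmod.
- have := (aP3 x y).1; rewrite /applyr_head !(ldE, rdE) => /esym E.
  by apply: zmod_from E _; rewrite /ras ?(lbar, rbar); zmod.
- have := (aP3 x y).2; rewrite /applyr_head !(ldE, rdE) => E.
  by apply: zmod_from E _; rewrite /ras /ias ?(lbar, rbar); zmod.
Qed.

Lemma las_mid a x y : gan a -> las x a y = - ias a x y.
Proof. by move=> aP; rewrite (gan2l aP) opprK. Qed.

Lemma las_right a x y : gan a -> las x y a = ias a x y.
Proof. by move=> aP; rewrite (gan2r aP) (las_mid _ _ aP) opprK. Qed.

Lemma ras_mid a x y : gan a -> ras x a y = - ias x y a.
Proof. by move=> aP; rewrite (gan3r aP) opprK. Qed.

(** * Closure under the dicommutator *)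

Section TwoElements.
Variables a b : D.
Hypotheses (aP : gan a) (bP : gan b).

Lemma ias_swap v : ias b v a = - ias a v b.
Proof. by rewrite (gan2l bP) (las_right _ _ aP). Qed.

Lemma ias_rot v : ias v a b = - ias b a v.
Proof. by rewrite (gan2l bP) -(gan2r bP) (gan1l aP) opprK. Qed.

(** The left side expands to six signed associators, each equal to [ias a v b]. *)
Lemma com_com v :
  com (com v b) a - com (com v a) b + com v (com a b) = ias a v b *+ 6.
Proof.
have -> : com (com v b) a - com (com v a) b + com v (com a b) =
    las v b a - ias b v a + ias a v b - ras a b v - las v a b + ras b a v.
  by rewrite /com /las /ias /ras !(ldE, rdE) !(lbar, rbar); zmod.
rewrite (las_right _ _ aP) (las_mid _ _ aP) (gan3l aP) (ras_mid _ _ aP).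
by rewrite ias_swap; zmod.
Qed.

Lemma gan_com : gan (com a b).
Proof.
have [la1 la2 la3] := (ganP a).1 aP; have [_ lb2 lb3] := (ganP b).1 bP.
apply/ganP; split.
(* For (GAN1) only [a] acts by a ⊣ _ and _ ⊢ a; [b] still acts by L_b and R_b. *)
- apply: (gnder_bracket la1 lb3 lb2 lb3) => v; rewrite /= /applyr_head.
  + have E : las a v b = ras v b a by rewrite (gan1l aP) (gan1r aP).
    have {}E := esym (eq_addr E (gan3l bP v a)).
    by apply: zmod_from E _; rewrite /las /ras ?(lbar, rbar); zmod.
  (* Here and below [E1] rewrites the mixed commutator, and is added twice because that commutator
     has coefficient 2. *)
  + have E1 := gan2r bP a v; have E2 := gan1l aP b v.
    apply: (zmod_from (eq_addr (eq_addr E1 E1) (esym E2))).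
    by rewrite /com !(ldE, rdE) /las /ias ?(lbar, rbar); zmod.
  + have E1 := gan1l aP v b; have E2 := gan1r aP v b.
    apply: (zmod_from (eq_addr (esym (eq_addr E1 E1)) E2)).
    by rewrite /com !(ldE, rdE) /las /ras /ias ?(lbar, rbar); zmod.
- apply: (gnder_bracket la2 lb2 lb2 lb2) => v; rewrite /= /applyr_head.
  + by apply: (zmod_from (esym (ias_swap v))); rewrite /ias; zmod.
  + have E1 := gan3r bP a v; have E2 := gan3l aP b v.
    apply: (zmod_from (eq_addr (eq_addr E1 E1) (esym E2))).
    by rewrite /com !(ldE, rdE) /ras /ias ?(lbar, rbar); zmod.
  + have E1 := las_mid v b aP; have E2 := gan2r aP v b.
    apply: (zmod_from (eq_addr (esym (eq_addr E1 E1)) E2)).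
    by rewrite /com !(ldE, rdE) /las /ias ?(lbar, rbar); zmod.
- apply: (gnder_bracket la3 lb3 lb3 lb3) => v; rewrite /= /applyr_head.
  + by apply: (zmod_from (esym (ias_swap v))); rewrite /ias; zmod.
  + have E1 := gan3r bP a v; have E2 := gan3l aP b v.
    apply: (zmod_from (eq_addr (eq_addr E1 E1) (esym E2))).
    by rewrite /com !(ldE, rdE) /ras /ias ?(lbar, rbar); zmod.
  + have E1 := las_mid v b aP; have E2 := gan2r aP v b.
    apply: (zmod_from (eq_addr (esym (eq_addr E1 E1)) E2)).
    by rewrite /com !(ldE, rdE) /las /ias ?(lbar, rbar); zmod.
Qed.

End TwoElements.

(** * The Malcev identities *)

(** Six times this relation is what [com_com] leaves of the di-Malcev identity. *)
Lemma ias_com x y z t : gan x -> gan y -> gan z -> gan t ->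
  ias (com y z) x t = ias y (com x t) z + ias t (com x z) y
    - com (ias z x t) y - com (ias y x z) t.
Proof.
move=> xP yP zP tP.
(* The two Teichmüller identities, for (y, z, x, t) and (t, x, z, y). *)
have T1 : ias (y ⊢ z) x t - ias y (z ⊢ x) t + ras y z (x ⊣ t) =
    y ⊢ ias z x t + ras y z x ⊣ t.
  by rewrite /ias /ras !(ldE, rdE); zmod.
have T2 : las (t ⊢ x) z y - ias t (x ⊣ z) y + ias t x (z ⊢ y) =
    t ⊢ las x z y + ias t x z ⊣ y.
  by rewrite /ias /las !(ldE, rdE) !rbar; zmod.
have -> : ias (com y z) x t = ias (y ⊢ z) x t - ias (z ⊢ y) x t.
  by rewrite /com /ias !(ldE, rdE) !lbar; zmod.
have -> : ias y (com x t) z = ias y (x ⊣ t) z - ias y (t ⊢ x) z.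
  by rewrite /com /ias !(ldE, rdE); zmod.
have -> : ias t (com x z) y = ias t (x ⊣ z) y - ias t (z ⊢ x) y.
  by rewrite /com /ias !(ldE, rdE); zmod.
(* With [z] in the middle, right and left associators become inner ones; swaps then align the outer
   arguments. *)
rewrite !(ras_mid _ _ zP) in T1; rewrite !linearNl in T1.
rewrite !(las_mid _ _ zP) !(ias_swap yP zP) (ias_swap zP tP) in T2.
rewrite !(linearNl, linearNr) in T2.
rewrite (ias_rot xP tP (z ⊢ y)) (ias_swap yP tP (z ⊢ x)) /com.
by apply: zmod_from (eq_addr T1 T2) _; zmod.
Qed.

(** The sum of [com y z] and [com z y] consists of differences u ⊣ v - u ⊢ v, killed by x ⊣ _ and by
    _ ⊢ x. *)
Lemma com_anticomm x y z : com x (com y z) + com x (com z y) = 0.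
Proof. by rewrite /com !(ldE, rdE) !(lbar, rbar); zmod. Qed.

Lemma malcev_com x y z t : gan x -> gan y -> gan z -> gan t ->
  com (com (com x y) z) t - com (com (com x t) y) z - com (com x (com z t)) y
    - com (com x z) (com y t) - com x (com (com y z) t) = 0.
Proof.
move=> xP yP zP tP.
have comDBl u v w r : com (u - v + w) r = com u r - com v r + com w r.
  by rewrite /com !(ldE, rdE); zmod.
have comMnl u v n : com (u *+ n) v = com u v *+ n.
  by rewrite /com linearMnl linearMnr mulrnBl.
(* Reverses the sign of the term [com (com x z) (com t y)] coming from [E3]. *)
have com_yt := com_anticomm (com x z) y t.
have E := congr1 (fun u => u *+ 6) (ias_com xP yP zP tP).
(* This instance needs closure: [com y z] must itself lie in the di-nucleus. *)
have E1 := com_com (gan_com yP zP) tP x.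
have E2 := com_com yP zP (com x t).
have E3 := com_com tP yP (com x z).
have E4 := congr1 (com^~ y) (com_com zP tP x).
have E5 := congr1 (com^~ t) (com_com yP zP x).
rewrite /= comDBl comMnl in E4; rewrite /= comDBl comMnl in E5.
have E45 := esym (eq_addr com_yt (eq_addr E4 E5)).
have E123 := eq_addr (esym E1) (eq_addr E2 E3).
by apply: zmod_from (eq_addr (esym E) (eq_addr E123 E45)) _; zmod.
Qed.

End BarIdentities.

(** * The dicommutator as a bilinear product on the di-nucleus *)

Section Dinucleus.
Variables (F : fieldType) (D : zeroDialgType F).

Lemma Nalt_gan (a : D) : a \in @Nalt F D <-> gan ldprod rdprod a.
Proof.
split=> [/NaltP[a1 a2 a3]|[a1l a1r a2l a2r a3l a3r]].
  by split=> x y; [have [] := a1 x y|have [_ ->] := a1 x y|have [] := a2 x y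
    |have [_ ->] := a2 x y|have [] := a3 x y|have [_ ->] := a3 x y].
apply/NaltP; split=> x y; split;
  by [exact: a1l|exact: esym (a1r x y)|exact: a2l|exact: esym (a2r x y)
     |exact: a3l|exact: esym (a3r x y)].
Qed.

Lemma Nalt_dicommutator (a b : D) :
  a \in @Nalt F D -> b \in @Nalt F D -> dicommutator a b \in @Nalt F D.
Proof.
by rewrite !Nalt_gan; exact: gan_com (@left_bar F D) (@right_bar F D) a b.
Qed.

Definition Nalt_mul (x y : Nalt_type D) : Nalt_type D :=
  NaltElt (Nalt_dicommutator (valP x) (valP y)).

Lemma Nalt_mul_bilinear : bilinear_for
  (GRing.Scale.Law.clone _ _ *:%R _) (GRing.Scale.Law.clone _ _ *:%R _)
  Nalt_mul.
Proof.
split=> w k u v; apply: val_inj; rewrite /= /dicommutator.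
  by rewrite linearPl linearPr scalerBr opprD addrACA.
by rewrite linearPl linearPr scalerBr opprD addrACA.
Qed.

HB.instance Definition _ := bilinear_isBilinear.Build F (Nalt_type D)
  (Nalt_type D) (Nalt_type D) _ _ Nalt_mul Nalt_mul_bilinear.

End Dinucleus.

Theorem theorem3p13 (F : fieldType) (char_neq2 : 2%N \notin [pchar F])
    (char_neq3 : 3%N \notin [pchar F]) (D : zeroDialgType F) :
  exists mul : {bilinear Nalt_type D -> Nalt_type D -> Nalt_type D},
    (forall x y : Nalt_type D,
       Nalt_val (mul x y) = dicommutator (Nalt_val x) (Nalt_val y)) /\
    malcev_dialgebra mul.
Proof.
have NaltP (u : Nalt_type D) := (Nalt_gan (val u)).1 (valP u).
exists (@Nalt_mul F D); split=> //; split=> // [x y z|x y z t]; apply: val_inj.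
  exact: com_anticomm (@left_bar F D) (@right_bar F D) (val x) (val y) (val z).
exact: malcev_com (@left_bar F D) (@right_bar F D) _ _ _ _
  (NaltP x) (NaltP y) (NaltP z) (NaltP t).
Qed.
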